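(* Let $\lambda_0(A)$ be a $G_1$-space whose Köthe matrix $A=(a_n)_n$ satisfies $\lim_{i\to\infty}a_n(i)=0$ for all $n\in\mathbb{N}$, and let $\mathsf{C}:\lambda_0(A)\to\lambda_0(A)$ be the Cesàro operator. Then the following statements are equivalent: (1) $0\notin\sigma(\mathsf{C};\lambda_0(A))$. (2) $\frac12\in\sigma_{pt}(\mathsf{C};\lambda_0(A))$. (3) There exists $s\in\mathbb{N}$, $s>1$, such that $\frac1s\in\sigma_{pt}(\mathsf{C};\lambda_0(A))$. (4) $\Sigma=\sigma_{pt}(\mathsf{C};\lambda_0(A))$.
   Context: $\mathbb{N}=\{1,2,3,\dots\}$. A Köthe matrix is $A=(a_n)_{n\in\mathbb{N}}$, $a_n=(a_n(i))_{i\in\mathbb{N}}$, with $0\le a_n(i)\le a_{n+1}(i)$ for all $i,n$, and such that for every $i$ there is $n$ with $a_n(i)>0$. The Köthe echelon space of order $0$ is $\lambda_0(A)=\{x\in\mathbb{C}^{\mathbb{N}}:\lim_{i\to\infty}a_n(i)x_i=0\ \forall n\in\mathbb{N}\}$, a Fréchet space with the seminorms $p_n(x)=\sup_{i}a_n(i)|x_i|$. It is called a $G_1$-space (smooth sequence space of finite type) if (G1-1) $0<a_n(i+1)\le a_n(i)$ for all $n,i\in\mathbb{N}$, and (G1-2) for all $n$ there exist $m>n$ and $C>0$ such that $a_n(i)\le C\,a_m(i)^2$ for all $i\in\mathbb{N}$. The Cesàro operator is $\mathsf{C}x=\left(\frac1i\sum_{j=1}^i x_j\right)_{i\in\mathbb{N}}$;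 it maps $\lambda_0(A)$ continuously into itself when (G1-1) holds. For a locally convex Hausdorff space $X$ let $\mathcal{L}(X)$ be the space of continuous linear operators on $X$. For $T\in\mathcal{L}(X)$ the resolvent set is the set of $\lambda\in\mathbb{C}$ such that $(\lambda I-T)^{-1}$ exists in $\mathcal{L}(X)$; the spectrum $\sigma(T;X)$ is its complement in $\mathbb{C}$; the point spectrum $\sigma_{pt}(T;X)$ is the set of $\lambda\in\mathbb{C}$ such that $\lambda I-T$ is not injective. $\Sigma=\{\frac1k:k\in\mathbb{N}\}$. *)

(* Defs.v *)
From HB Require Import structures.
From mathcomp Require Import all_boot all_order all_algebra.
From mathcomp Require Import complex.
From mathcomp Require Import all_classical all_reals all_analysis.

Set Implicit Arguments.
Unset Strict Implicit.
Unset Printing Implicit Defensive.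

Import Order.TTheory GRing.Theory Num.Theory.
Import numFieldNormedType.Exports.

Local Open Scope classical_set_scope.
Local Open Scope ring_scope.
Local Open Scope complex_scope.

(* The positive integers index both the sequences and the steps of a Köthe
   matrix; they are represented by nat through k |-> k.+1, so that A n i below
   is a_(n+1)(i+1) and x i is x_(i+1). *)

Record kotheMatrix (R : realType) := KotheMatrix {
  kothe_fun :> nat -> nat -> R;
  kothe_ge0 : forall n i, 0 <= kothe_fun n i;
  kothe_leS : forall n i, kothe_fun n i <= kothe_fun n.+1 i;
  kothe_gt0 : forall i, exists n, 0 < kothe_fun n i
}.

Record is_G1 (R : realType) (A : kotheMatrix R) : Prop := IsG1 {
  G1_1 : forall n i, 0 < A n i.+1 /\ A n i.+1 <= A n i;
  G1_2 : forall n, exists m (C : R),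
    [/\ (n < m)%N, 0 < C & forall i, A n i <= C * A m i ^+ 2]
}.

Definition lambda0_set (R : realType) (A : kotheMatrix R) : set (nat -> R[i]) :=
  [set x | forall n, (fun i => (A n i)%:C * x i : R[i]^o) @ \oo --> (0 : R[i]^o)].

Definition kothe_seminorm (R : realType) (A : kotheMatrix R) (n : nat)
    (x : nat -> R[i]) : R :=
  sup (range (fun i => A n i * Normc.normc (x i))).

Section Seminorms.
Variables (R : realType) (A : kotheMatrix R).
Implicit Types (x y : nat -> R[i]) (n : nat).
Local Notation p := (kothe_seminorm A).
Local Notation normc := Normc.normc.

Lemma normcE (z : R[i]) : `|z| = (normc z)%:C.
Proof. by case: z. Qed.

Lemma normc_ge0 (z : R[i]) : 0 <= normc z.
Proof. by have := normr_ge0 z; rewrite normcE lecR. Qed.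

Lemma normc_tri (x y : R[i]) : normc (x + y) <= normc x + normc y.
Proof. by rewrite -lecR rmorphD /= -!normcE ler_normD. Qed.

Lemma normc_real (r : R) : 0 <= r -> normc r%:C = r.
Proof. by move=> r0; apply/complexI; rewrite -normcE ger0_norm ?lecR. Qed.

Lemma kothe_homo n m i : (n <= m)%N -> A n i <= A m i.
Proof.
move=> /subnK <-; elim: (m - n)%N => // k IH.
by rewrite addSn (le_trans IH)// kothe_leS.
Qed.

Lemma lambda0_setP x : lambda0_set A x <->
  forall n, (fun i => A n i * normc (x i)) @ \oo --> (0 : R).
Proof.
split=> h n; apply/cvgrPdist_lt => e e0.
- have e0' : 0 < e%:C by rewrite ltcR.
  have /cvgrPdist_lt/(_ _ e0') := h n.
  apply: filterS => i; rewrite !sub0r !normrN normcE ltcR Normc.normcM.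
  by rewrite normc_real ?kothe_ge0// ger0_norm// mulr_ge0 ?kothe_ge0 ?normc_ge0.
- case: e e0 => e f; rewrite ltcE/= => /andP[/eqP -> e0].
  have /cvgrPdist_lt/(_ _ e0) := h n.
  apply: filterS => i; rewrite !sub0r !normrN [X in X -> _]/= normcE.
  rewrite (_ : _ +i* 0 = e%:C)// ltcR Normc.normcM.
  by rewrite normc_real ?kothe_ge0// ger0_norm// mulr_ge0 ?kothe_ge0 ?normc_ge0.
Qed.

Lemma lambda0_bounded x n : lambda0_set A x ->
  has_ubound (range (fun i => A n i * normc (x i))).
Proof.
move=> /lambda0_setP /(_ n) h.
have [M [_ hM]] := cvg_seq_bounded (cvgP _ h).
exists (M + 1) => _ [i _ <-].
rewrite (le_trans (ler_norm _))//.
by apply: (hM (M + 1)) => //; rewrite ltrDl.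
Qed.

Lemma kothe_seminorm_ub x n i : lambda0_set A x ->
  A n i * normc (x i) <= p n x.
Proof. by move=> /(@lambda0_bounded _ n) h; apply: ub_le_sup => //; exists i. Qed.

Lemma kothe_seminorm_le x n c :
  (forall i, A n i * normc (x i) <= c) -> p n x <= c.
Proof.
move=> h; apply: ge_sup; first by exists (A n 0%N * normc (x 0%N)); exists 0%N.
by move=> _ [i _ <-].
Qed.

Lemma kothe_seminorm_ge0 x n : lambda0_set A x -> 0 <= p n x.
Proof.
move=> hx; rewrite (le_trans _ (kothe_seminorm_ub n 0%N hx))//.
by rewrite mulr_ge0 ?kothe_ge0 ?normc_ge0.
Qed.

Lemma kothe_seminorm0 n : p n 0 = 0.
Proof.
have h i : A n i * normc ((0 : nat -> R[i]) i) = 0.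
  by rewrite [X in normc X](_ : _ = 0)// Normc.normc0 mulr0.
rewrite /kothe_seminorm [X in sup X](_ : _ = [set 0]) ?sup1//.
apply/seteqP; split=> [_ [i _ <-]|_ ->]; first exact: h.
by exists 0%N => //; rewrite h.
Qed.

Lemma kothe_seminorm_homo x n m : lambda0_set A x -> (n <= m)%N ->
  p n x <= p m x.
Proof.
move=> hx nm; apply: kothe_seminorm_le => i.
rewrite (le_trans _ (kothe_seminorm_ub m i hx))//.
by rewrite ler_wpM2r ?normc_ge0 ?kothe_homo.
Qed.

Lemma kothe_seminormD x y n : lambda0_set A x -> lambda0_set A y ->
  p n (x + y) <= p n x + p n y.
Proof.
move=> hx hy; apply: kothe_seminorm_le => i.
rewrite (le_trans _ (lerD (kothe_seminorm_ub n i hx) (kothe_seminorm_ub n i hy)))//.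
by rewrite -mulrDr ler_wpM2l ?kothe_ge0// normc_tri.
Qed.

Lemma kothe_seminormZ (k : R[i]) x n : lambda0_set A x ->
  p n (k *: x) <= normc k * p n x.
Proof.
move=> hx; apply: kothe_seminorm_le => i.
rewrite [X in normc X](_ : _ = k * x i)// Normc.normcM mulrCA.
by rewrite ler_wpM2l ?normc_ge0// kothe_seminorm_ub.
Qed.

End Seminorms.

Definition lambda0_pred (R : realType) (A : kotheMatrix R) :
  {pred (nat -> R[i])} := [in lambda0_set A].

Lemma lambda0_submod (R : realType) (A : kotheMatrix R) :
  submod_closed (lambda0_pred A).
Proof.
split=> [|k x y]; rewrite /lambda0_pred !inE /=.
  move=> n; rewrite (_ : (fun _ => _) = cst 0); first exact: cvg_cst.
  by apply/funext => i /=; rewrite mulr0.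
move=> hx hy n.
rewrite (_ : (fun i => _) =
  (fun i => k *: ((A n i)%:C * x i : R[i]^o) + ((A n i)%:C * y i : R[i]^o))).
  rewrite -[0]addr0 -[X in X + _](scaler0 _ k).
  by apply: cvgD => //; apply: cvgZr.
apply/funext => i.
by rewrite [LHS](_ : _ = (A n i)%:C * (k * x i + y i))// mulrDr mulrCA.
Qed.

HB.instance Definition _ (R : realType) (A : kotheMatrix R) :=
  GRing.isSubmodClosed.Build R[i] (nat -> R[i]) (lambda0_pred A)
    (lambda0_submod A).

Record lambda0 (R : realType) (A : kotheMatrix R) := Lambda0 {
  lambda0_val :> nat -> R[i];
  lambda0P : lambda0_val \in lambda0_pred A
}.

HB.instance Definition _ (R : realType) (A : kotheMatrix R) :=
  [isSub for @lambda0_val R A].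
HB.instance Definition _ (R : realType) (A : kotheMatrix R) :=
  [Choice of lambda0 A by <:].
HB.instance Definition _ (R : realType) (A : kotheMatrix R) :=
  [SubChoice_isSubLmodule of lambda0 A by <:].

(* Since the seminorms increase with n, their open balls (rather than finite
   intersections of such balls) form a base of neighbourhoods. *)
Definition lambda0_nbhs (R : realType) (A : kotheMatrix R) (x : lambda0 A) :
  set_system (lambda0 A) :=
  [set U | exists n (e : R), 0 < e /\
    [set y : lambda0 A | kothe_seminorm A n (y - x : lambda0 A) < e] `<=` U].

HB.instance Definition _ (R : realType) (A : kotheMatrix R) :=
  hasNbhs.Build (lambda0 A) (@lambda0_nbhs R A).

Section Topology.
Variables (R : realType) (A : kotheMatrix R).
Local Notation X := (lambda0 A).
Local Notation p := (kothe_seminorm A).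
Local Notation normc := Normc.normc.

Lemma lambda0_in (x : X) : lambda0_set A x.
Proof. by have := lambda0P x; rewrite /lambda0_pred inE. Qed.

Lemma lambda0_nbhsE (x : X) (U : set X) : nbhs x U <->
  exists n (e : R), 0 < e /\ [set y : X | p n (y - x : X) < e] `<=` U.
Proof. by []. Qed.

Lemma lambda0_seminormD (x y : X) n : p n (x + y : X) <= p n x + p n y.
Proof. by apply: kothe_seminormD; exact: lambda0_in. Qed.

Lemma lambda0_seminorm_tri (x y z : X) n :
  p n (x - z : X) <= p n (x - y : X) + p n (y - z : X).
Proof.
rewrite (_ : (x - z : X) = (x - y) + (y - z)); last by rewrite addrA subrK.
exact: lambda0_seminormD.
Qed.

Lemma lambda0_seminorm_mono (x : X) n m : (n <= m)%N -> p n x <= p m x.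
Proof. by apply: kothe_seminorm_homo; exact: lambda0_in. Qed.

Lemma lambda0_seminorm_ge0 (x : X) n : 0 <= p n x.
Proof. by apply: kothe_seminorm_ge0; exact: lambda0_in. Qed.

Lemma lambda0_seminormZ (k : R[i]) (x : X) n :
  p n (k *: x : X) <= normc k * p n x.
Proof. by apply: kothe_seminormZ; exact: lambda0_in. Qed.

Lemma lambda0_seminorm_sub (x : X) n : p n (x - x : X) = 0.
Proof. by rewrite subrr kothe_seminorm0. Qed.

Let lambda0_nbhs_filter (x : X) : ProperFilter (nbhs x).
Proof.
split.
  move=> [n [e [e0 /(_ x)]]]; apply; rewrite /=.
  by rewrite lambda0_seminorm_sub.
split.
- by exists 0%N, 1; split.
- move=> U V [n [e [e0 hU]]] [m [f [f0 hV]]].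
  exists (maxn n m), (Num.min e f); split; first by rewrite lt_min e0.
  move=> y /=; rewrite lt_min => /andP[ye yf]; split.
  + by apply/hU/(le_lt_trans _ ye); apply: lambda0_seminorm_mono; exact: leq_maxl.
  + by apply/hV/(le_lt_trans _ yf); apply: lambda0_seminorm_mono; exact: leq_maxr.
- move=> U V UV [n [e [e0 hU]]]; exists n, e; split=> //.
  exact: subset_trans UV.
Qed.

Let lambda0_nbhs_singleton (x : X) (U : set X) : nbhs x U -> U x.
Proof.
by move=> [n [e [e0 /(_ x)]]]; apply; rewrite /= lambda0_seminorm_sub.
Qed.

Let lambda0_nbhs_nbhs (x : X) (U : set X) : nbhs x U -> nbhs x (nbhs^~ U).
Proof.
move=> [n [e [e0 hU]]]; exists n, e; split=> // y /= xy.
exists n, (e - p n (y - x : X)); split; first by rewrite subr_gt0.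
move=> z /=; rewrite ltrBrDr => yz; apply: hU => /=.
exact: le_lt_trans (lambda0_seminorm_tri z y x n) yz.
Qed.

HB.instance Definition _ := Nbhs_isNbhsTopological.Build X
  lambda0_nbhs_filter lambda0_nbhs_singleton lambda0_nbhs_nbhs.

Lemma lambda0_nbhs_ball (x : X) n (e : R) : 0 < e ->
  nbhs x [set y : X | p n (y - x : X) < e].
Proof. by move=> e0; exists n, e; split. Qed.

Let lambda0_add_continuous : continuous (fun z : X * X => z.1 + z.2).
Proof.
move=> [x y] U /= [n [e [e0 hU]]].
have e2 : 0 < e / 2 by rewrite divr_gt0.
exists ([set x' : X | p n (x' - x : X) < e / 2],
        [set y' : X | p n (y' - y : X) < e / 2]).
  by split; exact: lambda0_nbhs_ball.
move=> [x' y'] /= [hx hy]; apply: hU.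
suff : p n ((x' : X) + y' - ((x : X) + y) : X) < e by [].
have -> : ((x' : X) + y' - ((x : X) + y) : X) = ((x' : X) - x) + ((y' : X) - y).
  by rewrite opprD addrACA.
rewrite (le_lt_trans (lambda0_seminormD _ _ _))//.
by rewrite [ltRHS]splitr ltrD.
Qed.

Let lambda0_scale_continuous : continuous (fun z : R[i]^o * X => z.1 *: z.2).
Proof.
move=> [k x] U /= [n [e [e0 hU]]].
pose M := normc k + 1.
have M0 : 0 < M by rewrite ltr_wpDl ?normc_ge0.
pose q := p n x + 1.
have q0 : 0 < q by rewrite ltr_wpDl ?lambda0_seminorm_ge0.
pose d := Num.min 1 (e / 2 / q).
have d0 : 0 < d by rewrite lt_min ltr01 !divr_gt0.
exists ([set k' : R[i]^o | `|k - k'| < d%:C],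
        [set x' : X | p n (x' - x : X) < e / 2 / M]).
  split; last by apply: lambda0_nbhs_ball; rewrite !divr_gt0.
  have dC : 0 < d%:C :> R[i] by rewrite ltcR.
  by have := nbhsx_ballx (k : R[i]^o) _ dC; rewrite -ball_normE.
move=> [k' x'] /= [hk hx]; apply: hU.
suff : p n ((k' : R[i]) *: (x' : X) - (k : R[i]) *: (x : X) : X) < e by [].
have -> : ((k' : R[i]) *: (x' : X) - (k : R[i]) *: (x : X) : X) =
    (k' : R[i]) *: ((x' : X) - x) + ((k' : R[i]) - k) *: (x : X).
  by rewrite scalerBr scalerBl addrA subrK.
rewrite (le_lt_trans (lambda0_seminormD _ _ _))//.
have {}hk : normc (k' - k) < d by rewrite -ltcR -normcE distrC.
have hM : normc k' <= M.
  rewrite (_ : k' = k + (k' - k)); last by rewrite addrC subrK.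
  rewrite (le_trans (normc_tri _ _))// lerD2l.
  by rewrite (le_trans (ltW hk))// ge_min lexx.
rewrite [ltRHS]splitr ltr_leD//.
- rewrite (le_lt_trans (lambda0_seminormZ _ _ _))//.
  rewrite (@le_lt_trans _ _ (M * p n (x' - x : X)))//.
    by rewrite ler_wpM2r ?lambda0_seminorm_ge0.
  by rewrite mulrC -ltr_pdivlMr.
- rewrite (le_trans (lambda0_seminormZ _ _ _))//.
  rewrite (@le_trans _ _ (d * q))//.
    by rewrite ler_pM ?normc_ge0 ?lambda0_seminorm_ge0 ?ltW// /q ltrDl.
  by rewrite -ler_pdivlMr// ge_min lexx orbT.
Qed.

Let lambda0_locally_convex :
  exists2 B : set_system X, (forall b, b \in B -> convex_set b) & basis B.
Proof.
exists [set U | exists (x : X) n (e : R), U = [set y : X | p n (y - x : X) < e]].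
  move=> U /[!inE] -[x [n [e ->]]] y z t /[!inE] /= hy hz.
  have [t0 t1] : 0 <= complex.Re t%:num /\ complex.Re t%:num <= 1.
    have : 0 <= t%:num <= 1 by rewrite ge0 le1.
    by rewrite !lecE /=; move=> /andP[/andP[_ ->] /andP[_ ->]].
  have tE : t%:num = (complex.Re t%:num)%:C.
    have : 0 <= t%:num by [].
    by case: (t%:num) => a b; rewrite lecE /= => /andP[/eqP -> _].
  set r := complex.Re t%:num in tE t0 t1.
  suff : p n (r%:C *: (y : X) + (1 - r%:C) *: (z : X) - x : X) < e.
    by rewrite -tE.
  have -> : r%:C *: (y : X) + (1 - r%:C) *: (z : X) - x =
      r%:C *: ((y : X) - x) + (1 - r%:C) *: ((z : X) - x).
    rewrite !scalerBr addrACA -opprD -scalerDl.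
    by rewrite [r%:C + _]addrC subrK scale1r.
  rewrite (le_lt_trans (lambda0_seminormD _ _ _))//.
  rewrite (le_lt_trans (lerD (lambda0_seminormZ _ _ _) (lambda0_seminormZ _ _ _)))//.
  have -> : 1 - r%:C = (1 - r)%:C :> R[i] by rewrite rmorphB rmorph1.
  rewrite !normc_real ?subr_ge0//.
  pose m := Num.max (p n ((y : X) - x : X)) (p n ((z : X) - x : X)).
  rewrite (@le_lt_trans _ _ m)//; last by rewrite gt_max; apply/andP; split.
  rewrite [leRHS](_ : m = r * m + (1 - r) * m); last first.
    by rewrite -mulrDl addrC subrK mul1r.
  by rewrite lerD// ler_wpM2l ?subr_ge0// le_max lexx ?orbT.
split.
  move=> U [x [n [e ->]]]; rewrite openE => y /= hy.
  exists n, (e - p n (y - x : X)); split; first by rewrite subr_gt0.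
  move=> z /=; rewrite ltrBrDr => yz.
  exact: le_lt_trans (lambda0_seminorm_tri z y x n) yz.
move=> x U [n [e [e0 hU]]].
exists [set y : X | p n (y - x : X) < e] => //; split; first by exists x, n, e.
by rewrite /= lambda0_seminorm_sub.
Qed.

HB.instance Definition _ :=
  PreTopologicalNmodule_isTopologicalNmodule.Build X lambda0_add_continuous.
HB.instance Definition _ :=
  TopologicalNmodule_isTopologicalLmodule.Build R[i] X lambda0_scale_continuous.
(* This factory only contributes the uniform structure. *)
HB.instance Definition _ := PreTopologicalLmod_isTvs.Build R[i] X
  lambda0_add_continuous lambda0_scale_continuous lambda0_locally_convex.
HB.instance Definition _ := Uniform_isTvs.Build R[i] X lambda0_locally_convex.

Lemma lambda0_hausdorff : hausdorff_space X.
Proof.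
move=> x y xy; apply/val_inj/funext => i /=.
have [n An] := kothe_gt0 A i.
apply/eqP; rewrite -subr_eq0; apply/eqP; apply: Normc.eq0_normc.
apply/eqP; rewrite eq_le normc_ge0 andbT leNgt; apply/negP => d0.
pose e := A n i * normc (x i - y i) / 2.
have e0 : 0 < e by rewrite divr_gt0// mulr_gt0.
have [z [zx zy]] := xy _ _ (lambda0_nbhs_ball x n e0) (lambda0_nbhs_ball y n e0).
have hx : A n i * normc (z i - x i) < e.
  exact: le_lt_trans (kothe_seminorm_ub n i (lambda0_in (z - x))) zx.
have hy : A n i * normc (z i - y i) < e.
  exact: le_lt_trans (kothe_seminorm_ub n i (lambda0_in (z - y))) zy.
have : A n i * normc (x i - y i) < e + e.
  rewrite (le_lt_trans _ (ltrD hx hy))// -mulrDr ler_wpM2l ?kothe_ge0//.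
  rewrite -lecR rmorphD /= -!normcE (distrC (z i)).
  by rewrite (le_trans _ (ler_normD _ _))// addrA subrK.
by rewrite -splitr ltxx.
Qed.

End Topology.

#[short(type="continuousLinearType")]
HB.structure Definition ContinuousLinear (K : numDomainType) (X Y : tvsType K) :=
  {f of @GRing.Linear K X Y *:%R f & @Continuous X Y f}.

Definition resolvent_set (K : numFieldType) (X : tvsType K) (T : continuousLinearType X X) : set K :=
  [set l | exists S : continuousLinearType X X,
    (forall x, S (l *: x - T x) = x) /\ (forall x, l *: S x - T (S x) = x)].

Definition spectrum (K : numFieldType) (X : tvsType K) (T : continuousLinearType X X) : set K :=
  ~` resolvent_set T.

Definition point_spectrum (K : numFieldType) (X : tvsType K) (T : continuousLinearType X X) : set K :=
  [set l | ~ injective (fun x : X => l *: x - T x)].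

Definition unit_fractions {K : numFieldType} : set K :=
  range (fun k : nat => k.+1%:R^-1).

Section Cesaro.
Variables (R : realType) (A : kotheMatrix R) (hA : is_G1 A).
Local Notation X := (lambda0 A).
Local Notation p := (kothe_seminorm A).
Local Notation normc := Normc.normc.

Lemma normc_sum (n : nat) (F : 'I_n -> R[i]) :
  normc (\sum_(j < n) F j) <= \sum_(j < n) normc (F j).
Proof.
elim/big_rec2: _ => [|j y z _ IH]; first by rewrite Normc.normc0.
by rewrite (le_trans (normc_tri _ _))// lerD2l.
Qed.

Lemma arithmetic_mean_weight (x : nat -> R[i]) n i :
  A n i * normc (arithmetic_mean x i) <=
  arithmetic_mean (fun j => A n j * normc (x j)) i.
Proof.
have hj j : (j <= i)%N -> A n i <= A n j.
  move=> /subnK <-; elim: (i - j)%N => // k IH.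
  by rewrite addSn (le_trans _ IH)//; have [] := G1_1 hA n (k + j).
rewrite /arithmetic_mean /series /= Normc.normcM mulrCA.
have -> : normc (i.+1%:R^-1 : R[i]) = (i.+1%:R)^-1.
  by apply/complexI; rewrite -normcE ger0_norm ?invr_ge0// fmorphV rmorph_nat.
rewrite ler_wpM2l ?invr_ge0//.
rewrite !big_mkord.
apply: (@le_trans _ _ (A n i * \sum_(j < i.+1) normc (x j))).
  by rewrite ler_wpM2l ?kothe_ge0 ?normc_sum.
rewrite mulr_sumr; apply: ler_sum => j _.
by rewrite ler_wpM2r ?normc_ge0// hj// -ltnS.
Qed.

Lemma lambda0_arithmetic_mean (x : X) :
  arithmetic_mean (x : nat -> R[i]) \in lambda0_pred A.
Proof.
rewrite /lambda0_pred inE; apply/lambda0_setP => n.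
have /lambda0_setP /(_ n) /cesaro h := lambda0_in x.
apply: (squeeze_cvgr _ (cvg_cst 0) h); near=> i.
by rewrite mulr_ge0 ?kothe_ge0 ?normc_ge0//= arithmetic_mean_weight.
Unshelve. all: by end_near. Qed.

(* arithmetic_mean x i is the mean of x 0, ..., x i. *)
Definition cesaro_op (x : X) : X := Lambda0 (lambda0_arithmetic_mean x).

Lemma cesaro_op_linear : linear cesaro_op.
Proof.
move=> k x y; apply/val_inj/funext => i /=.
rewrite [RHS](_ : _ = k * arithmetic_mean x i + arithmetic_mean y i)//.
rewrite /arithmetic_mean /series /= mulrCA -mulrDr; congr (_ * _).
by rewrite mulr_sumr -big_split.
Qed.

Lemma kothe_seminorm_cesaro (x : X) n : p n (cesaro_op x) <= p n x.
Proof.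
apply: kothe_seminorm_le => i; rewrite (le_trans (arithmetic_mean_weight _ _ _))//.
rewrite /arithmetic_mean /series /= mulrC ler_pdivrMr// big_mkord.
rewrite (@le_trans _ _ (\sum_(j < i.+1) p n x))//.
  by apply: ler_sum => j _; apply: kothe_seminorm_ub; exact: lambda0_in.
by rewrite sumr_const card_ord mulr_natr.
Qed.

HB.instance Definition _ :=
  GRing.isLinear.Build R[i] X X *:%R cesaro_op cesaro_op_linear.

Lemma cesaro_op_continuous : continuous cesaro_op.
Proof.
move=> x U [n [e [e0 hU]]]; exists n, e; split=> // y /= hy; apply: hU.
have cB : cesaro_op y - cesaro_op (x : X) = cesaro_op (y - (x : X)).
  by rewrite linearB.
suff : p n (cesaro_op y - cesaro_op (x : X) : X) < e by [].
by rewrite cB (le_lt_trans (kothe_seminorm_cesaro _ _)).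
Qed.

HB.instance Definition _ := isContinuous.Build X X cesaro_op cesaro_op_continuous.

End Cesaro.

(* Main.v *)
(* All four statements amount to [i a_n(i) -> 0] for every n (linear_decay).
   If -C has a continuous inverse, evaluating it at multiples of the unit
   vectors gives [i a_n(i) <= D a_m(i)].  An eigenvector for 1/s with s > 1 has
   entries x_i = 'C(i - 1, s - 1) up to a factor, hence grows at least linearly.
   Conversely, (G1-2) bootstraps linear decay to [i^t a_n(i) -> 0] for every t,
   so that all these binomial sequences lie in the space, and to
   [i a_n(i) <= D a_m(i)], so that the inverse
   y |-> (i y_i - (i - 1) y_(i-1)) of C is continuous. *)

Require Import Defs.
From HB Require Import structures.
From mathcomp Require Import all_boot all_order all_algebra.
From mathcomp Require Import complex.
From mathcomp Require Import all_classical all_reals all_analysis.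
From mathcomp Require Import ring.

Import Order.TTheory GRing.Theory Num.Theory.
Import numFieldNormedType.Exports.

Local Open Scope classical_set_scope.
Local Open Scope ring_scope.
Local Open Scope complex_scope.

Local Notation normc := Normc.normc.

(** * Linear decay, and the Cesàro map on arbitrary sequences *)

Definition linear_decay {R : realType} (A : kotheMatrix R) : Prop :=
  forall n, (fun i => i.+1%:R * A n i) @ \oo --> (0 : R).

(* The junk value y (0.-1) = y 0 is multiplied by 0. *)
Definition cesaro_inv {R : realType} (y : nat -> R[i]) (j : nat) : R[i] :=
  j.+1%:R * y j - j%:R * y j.-1.

Lemma normc_nat (R : realType) (n : nat) : normc (n%:R : R[i]) = n%:R.
Proof. by rewrite -[n%:R](rmorph_nat (@real_complex R)) normc_real. Qed.

Lemma normcN (R : realType) (z : R[i]) : normc (- z) = normc z.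
Proof. by apply/complexI; rewrite -!Defs.normcE normrN. Qed.

(** The entries of [cesaro_inv y] are the increments of [k * y k.-1], so their sum telescopes. *)
Lemma cesaro_invK (R : realType) : cancel (@cesaro_inv R) (@arithmetic_mean R[i]).
Proof.
move=> y; apply/funext => j; rewrite /arithmetic_mean /series /=.
rewrite (telescope_sumr_eq (fun k => k%:R * y k.-1))//.
by rewrite mul0r subr0 mulKf// pnatr_eq0.
Qed.

Lemma arithmetic_meanK (R : realType) : cancel (@arithmetic_mean R[i]) (@cesaro_inv R).
Proof.
move=> x; apply/funext => -[|j]; rewrite /cesaro_inv /arithmetic_mean /series /=.
  by rewrite big_nat1 mul0r subr0 invr1 !mul1r.
rewrite !mulVKf ?pnatr_eq0// big_nat_recr//=.
by rewrite [X in X - _]addrC addrK.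
Qed.

(** Applying [cesaro_inv] to the eigenvalue equation yields the recursion; conversely, the recursion
    gives the partial sums [l * i.+1 * x i] by induction. *)
Lemma cesaro_eigenP (R : realType) (l : R[i]) (x : nat -> R[i]) :
  (forall i, arithmetic_mean x i = l * x i) <->
  (l - 1) * x 0%N = 0 /\
  forall i, (l * i.+2%:R - 1) * x i.+1 = l * i.+1%:R * x i.
Proof.
split=> [h|[h0 h] i].
  have hx i : x i = i.+1%:R * (l * x i) - i%:R * (l * x i.-1).
    by rewrite -{1}[x]arithmetic_meanK /cesaro_inv !h.
  split=> [|i]; first by rewrite mulrBl mul1r {2}hx; ring.
  by rewrite mulrBl mul1r {2}hx /=; ring.
have sE : \sum_(0 <= k < i.+1) x k = l * i.+1%:R * x i.
  elim: i => [|i IH]; last by rewrite big_nat_recr//= IH -h; ring.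
  by rewrite big_nat1 mulr1; apply/esym/eqP; rewrite -subr_eq0 -{2}[x 0%N]mul1r -mulrBl h0.
by rewrite /arithmetic_mean /series /= sE mulrAC mulrC mulfK// pnatr_eq0.
Qed.

(** * Decay rates of the Köthe matrix *)

Section DecayRates.
Context {R : realType} {A : kotheMatrix R} (hA : is_G1 A).

Lemma G1_gt0 n i : 0 < A n i.
Proof. by have [h1 h2] := G1_1 hA n i; exact: lt_le_trans h2. Qed.

(** (G1-2) supplies the square of [A m i]: linear decay bounds [i.+1 * A m i], which uses up one
    factor and leaves the other. *)
Lemma linear_decay_dom : linear_decay A -> forall n, exists m (D : R),
  0 < D /\ forall i, i.+1%:R * A n i <= D * A m i.
Proof.
move=> K n; have [m [C [_ C0 hC]]] := G1_2 hA n.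
have [M [_ hM]] := cvg_seq_bounded (cvgP _ (K m)).
have hM1 i : i.+1%:R * A m i <= `|M| + 1.
  rewrite (le_trans (ler_norm _))//; apply: (hM (`|M| + 1)) => //.
  by rewrite ltr_pwDr// ler_norm.
exists m, (C * (`|M| + 1)); split; first by rewrite mulr_gt0// ltr_wpDl.
move=> i; rewrite (@le_trans _ _ (i.+1%:R * (C * A m i ^+ 2)))//.
  by rewrite ler_wpM2l.
rewrite expr2 (_ : _ * _ = C * (i.+1%:R * A m i) * A m i); last by ring.
by rewrite ler_wpM2r ?kothe_ge0// ler_wpM2l// ltW.
Qed.

(** By [linear_decay_dom], each induction step trades one factor [i.+1] for a passage from [n] to
    another index [m]. *)
Lemma linear_decay_pow (K : linear_decay A) n t :
  (fun i => i.+1%:R ^+ t.+1 * A n i) @ \oo --> (0 : R).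
Proof.
elim: t n => [|t IH] n; first exact: K.
have [m [D [_ hD]]] := linear_decay_dom K n.
have h : (fun i => D * (i.+1%:R ^+ t.+1 * A m i)) @ \oo --> (0 : R).
  by rewrite -(mulr0 D); apply: cvgM; [exact: cvg_cst|exact: IH].
apply: (squeeze_cvgr _ (cvg_cst 0) h); near=> i.
rewrite mulr_ge0 ?exprn_ge0 ?kothe_ge0//= exprSr -mulrA.
by rewrite [leRHS]mulrCA ler_wpM2l ?exprn_ge0.
Unshelve. all: by end_near. Qed.

Lemma dom_linear_decay :
  (forall n : nat, A n i @[i --> \oo] --> (0 : R)) ->
  (forall n, exists m (D : R), forall i, i.+1%:R * A n i <= D * A m i) ->
  linear_decay A.
Proof.
move=> A0 dom n; have [m [D hD]] := dom n.
have h : (fun i => D * A m i) @ \oo --> (0 : R).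
  by rewrite -(mulr0 D); apply: cvgM; [exact: cvg_cst|exact: A0].
apply: (squeeze_cvgr _ (cvg_cst 0) h); near=> i.
by rewrite mulr_ge0 ?kothe_ge0//=.
Unshelve. all: by end_near. Qed.

End DecayRates.

(** Pascal's rule, with (n+1)^(t+1) + (n+1)^t = (n+2)(n+1)^t. This polynomial bound later puts the
    binomial sequences into the space. *)
Lemma bin_leq_expS n t : ('C(n, t) <= n.+1 ^ t)%N.
Proof.
elim: n t => [|n IH] [|t]//.
rewrite binS (leq_trans (leq_add (IH _) (IH _)))// expnS -[X in (_ + X)%N]mul1n.
by rewrite -mulnDl addn1 [leqRHS]expnS leq_mul2l /=; case: t => // t; rewrite leq_exp2r.
Qed.

Lemma point_spectrumP (K : numFieldType) (X : tvsType K)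
    (T : continuousLinearType X X) (l : K) :
  point_spectrum T l <-> exists2 x : X, x <> 0 & T x = l *: x.
Proof.
split=> [inj|[x x0 xE] inj].
  apply: contrapT => h; apply: (inj) => x y /= xy; apply/subr0_eq.
  apply: contrapT => xy0; apply: h; exists (x - y) => //.
  rewrite linearB scalerBr -[l *: x](subrK (T x)) [X in X + T x]xy.
  by rewrite addrAC (addrAC (l *: y)) subrr add0r addrC.
by apply/x0/inj; rewrite xE subrr scaler0 linear0 subrr.
Qed.

(** * Linear decay against the resolvent at 0 and the point spectrum *)

Section CesaroSpectrum.
Context {R : realType} {A : kotheMatrix R} (hA : is_G1 A).
Hypothesis A_to0 : forall n : nat, A n i @[i --> \oo] --> (0 : R).
Local Notation X := (lambda0 A).
Local Notation C := (cesaro_op hA).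

Lemma lambda0_memP (x : nat -> R[i]) : x \in lambda0_pred A <->
  forall n, (fun i => A n i * normc (x i)) @ \oo --> (0 : R).
Proof. by rewrite /lambda0_pred inE; exact: lambda0_setP. Qed.

Lemma cesaro_point_spectrumP (l : R[i]) : point_spectrum C l <->
  exists2 x : nat -> R[i], x \in lambda0_pred A &
  [/\ exists i, x i != 0, (l - 1) * x 0%N = 0 &
     forall i, (l * i.+2%:R - 1) * x i.+1 = l * i.+1%:R * x i].
Proof.
rewrite point_spectrumP; split=> [[x x0 xE]|[x xA [[i xi] x0 xS]]].
  exists x; first exact: lambda0P.
  have /cesaro_eigenP[h0 hS] : forall i, arithmetic_mean (x : nat -> R[i]) i = l * x i.
    by move=> i; have := congr1 (fun y : X => (y : nat -> R[i]) i) xE.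
  split=> //; apply: contrapT => hx; apply/x0/val_inj/funext => i /=.
  by apply/eqP; apply: contrapT => /negP xi; apply: hx; exists i.
exists (Lambda0 xA).
  by move=> /(congr1 (fun y : X => (y : nat -> R[i]) i))/= xi0; rewrite xi0 eqxx in xi.
apply/val_inj/funext => j /=.
by have /cesaro_eigenP := conj x0 xS; exact.
Qed.

Lemma resolvent0_linear_decay : resolvent_set C 0 -> linear_decay A.
Proof.
move=> [S [_ hS]]; apply: dom_linear_decay => // n.
have : S @ (0 : X) --> S 0 by exact: cts_fun.
move=> /(_ _ (lambda0_nbhs_ball (S 0) n ltr01)) [m [d [d0 hd]]].
exists m, (2 / d) => i.
have Am := G1_gt0 hA m i.
(* Chosen so that the multiple [c] of the unit vector at [i] has [m]-th seminorm [d / 2], inside the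
   ball that [S] maps into the unit ball of the [n]-th seminorm around [S 0]. *)
pose c := d / 2 / A m i.
have c0 : 0 < c by rewrite !divr_gt0.
pose e (j : nat) : R[i] := if j == i then c%:C else 0.
have eA : e \in lambda0_pred A.
  apply/lambda0_memP => k; apply: cvg_near_cst; exists i.+1 => // j /= ij.
  by rewrite /e gtn_eqF// Normc.normc0 mulr0.
pose E : X := Lambda0 eA.
have pE : kothe_seminorm A m (E - 0 : X) < d.
  rewrite subr0 (@le_lt_trans _ _ (d / 2))//; last by rewrite ltr_pdivrMr// ltr_pMr// ltr1n.
  apply: kothe_seminorm_le => j /=; rewrite /e; case: eqP => [->|_].
    by rewrite normc_real ?(ltW c0)// /c mulrC divfK// lt0r_neq0.
  by rewrite Normc.normc0 mulr0 ltW// divr_gt0.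
have {hd pE} := hd _ pE; rewrite /= linear0 subr0 => pS.
have SE : (S E : nat -> R[i]) = cesaro_inv (fun j => - e j).
  rewrite -[LHS]arithmetic_meanK; congr cesaro_inv; apply/funext => j.
  have := congr1 (fun y : X => - (y : nat -> R[i]) j) (hS E).
  by rewrite scale0r sub0r /= opprK.
have SEi : normc ((S E : nat -> R[i]) i) = i.+1%:R * c.
  rewrite SE /cesaro_inv {1}/e eqxx.
  (* For [i > 0] the entry [e i.-1] is 0; for [i = 0], where [i.-1 = i], the factor [i] is 0. *)
  have -> : i%:R * - e i.-1 = 0.
    rewrite /e; case: eqP => [|_]; last by rewrite oppr0 mulr0.
    by case: (i) => [_|k /n_Sn//]; rewrite mul0r.
  by rewrite subr0 Normc.normcM normcN normc_nat normc_real// ltW.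
have := le_lt_trans (kothe_seminorm_ub n i (lambda0_in (S E))) pS.
rewrite SEi /c => h; rewrite mulrAC ler_pdivlMr//.
have -> : i.+1%:R * A n i * d = (A n i * (i.+1%:R * (d / 2 / A m i))) * (2 * A m i).
  by field; rewrite gt_eqF.
by rewrite ltW// gtr_pMl// mulr_gt0.
Qed.

Lemma point_spectrum_linear_decay (s : nat) : (1 < s)%N ->
  point_spectrum C s%:R^-1 -> linear_decay A.
Proof.
case: s => [|[|t]]// _ /cesaro_point_spectrumP[x /lambda0_memP xA [[j xj] x0 xS]] n.
have sN0 : t.+2%:R != 0 :> R[i] by rewrite pnatr_eq0.
have {}xS i : (i.+2%:R - t.+2%:R) * x i.+1 = i.+1%:R * x i.
  rewrite -[i.+1%:R](mulVKf sN0) -!mulrA [t.+2%:R^-1 * _]mulrA -xS !mulrA; congr (_ * _).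
  by field.
(* The coefficient [i.+2 - t.+2] vanishes only at [i = t], so the zero initial value propagates up
   to index [t], and [x t.+1] is free. *)
have x_lt i : (i < t.+1)%N -> x i = 0.
  elim: i => [_|i IH it].
    apply/eqP; move/eqP: x0; rewrite mulf_eq0 subr_eq0 -[X in _ == X]invr1.
    by rewrite (inj_eq invr_inj) pnatr_eq1.
  apply/eqP; have /eqP := xS i; rewrite IH ?(ltnW it)// mulr0 mulf_eq0.
  by rewrite subr_eq0 eqr_nat !eqSS ltn_eqF.
have xS' k : k.+1%:R * x (t.+1 + k.+1)%N = (t.+1 + k).+1%:R * x (t.+1 + k)%N.
  rewrite addnS -xS -natrB; first by rewrite subSS -addnS addKn.
  by rewrite !ltnS addSn -addnS leq_addr.
(* Otherwise the recursion would make all later entries vanish too, and [x] would be 0. *)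
have xt0 : 0 < normc (x t.+1).
  rewrite lt_def normc_ge0 andbT; apply/eqP => /Normc.eq0_normc xt.
  move/eqP: xj; apply; have [/x_lt//|/subnKC <-] := ltnP j t.+1.
  elim: (j - t.+1)%N => [|k IH]; first by rewrite addn0.
  by apply/eqP; have /eqP := xS' k; rewrite IH mulr0 mulf_eq0 pnatr_eq0.
(* The ratio of successive moduli is (t+k+2)/(k+1), hence at least (k+2)/(k+1). *)
have xge k : k.+1%:R * normc (x t.+1) <= normc (x (t.+1 + k)%N).
  elim: k => [|k IH]; first by rewrite addn0 mul1r.
  have /(congr1 (@Normc.normc R)) := xS' k; rewrite !Normc.normcM !normc_nat => xk.
  rewrite -(ler_pM2l (ltr0Sn R k)) xk mulrCA.
  apply: ler_pM; rewrite ?mulr_ge0 ?normc_ge0//.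
  by rewrite ler_nat addSn !ltnS leq_addl.
(* With i = t+1+k, the constant comes from i+1 = t+2+k <= (t+2)(k+1). *)
pose D : R := t.+2%:R / normc (x t.+1).
have h : (fun i => D * (A n i * normc (x i))) @ \oo --> (0 : R).
  by rewrite -(mulr0 D); apply: cvgM; [exact: cvg_cst|exact: xA].
apply: (squeeze_cvgr _ (cvg_cst 0) h); near=> i.
rewrite mulr_ge0 ?kothe_ge0//= mulrCA mulrC ler_wpM2l ?kothe_ge0//.
rewrite /D mulrAC ler_pdivlMr//.
have /subnKC <- : (t.+1 <= i)%N by near: i; exact: nbhs_infty_ge.
set k := (i - t.+1)%N.
rewrite (@le_trans _ _ (t.+2%:R * (k.+1%:R * normc (x t.+1))))//; last first.
  by rewrite ler_wpM2l.
rewrite mulrA ler_wpM2r ?normc_ge0// -natrM ler_nat.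
by rewrite mulnS -addSn leq_add2l leq_pmull.
Unshelve. all: by end_near. Qed.

Lemma linear_decay_spectrum : linear_decay A ->
  unit_fractions = point_spectrum C.
Proof.
move=> K; apply/seteqP; split=> [_ [t _ <-]|l /cesaro_point_spectrumP].
  apply/cesaro_point_spectrumP; exists (fun i => 'C(i, t)%:R).
    apply/lambda0_memP => n.
    apply: (squeeze_cvgr _ (cvg_cst 0) (linear_decay_pow hA K n t)); near=> i.
    rewrite mulr_ge0 ?normc_ge0 ?kothe_ge0//= normc_nat mulrC.
    rewrite ler_wpM2r ?kothe_ge0// -natrX ler_nat.
    by rewrite (leq_trans (bin_leq_expS _ _))// leq_pexp2l.
  have tN0 : t.+1%:R != 0 :> R[i] by rewrite pnatr_eq0.
  split=> [||i].
  - by exists t; rewrite binn oner_eq0.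
  - by case: t tN0 => [|t] _; rewrite ?invr1 ?subrr ?mul0r ?bin0n ?mulr0.
  (* Up to the factor [t.+1], the recursion is (i+1-t) C(i+1,t) = (i+1) C(i,t). The subtraction in
     nat is faithful only for [t <= i.+1]; beyond that both binomials are 0. *)
  - have /(congr1 (fun k => k%:R : R[i])) := mul_bin_down i.+1 t.
    have [ti|ti] := leqP t i.+1; last by rewrite !bin_small ?mulr0// ltnW.
    rewrite !natrM natrB//= -mulrA => ->.
    by rewrite -!natr1; field; rewrite natr1.
move=> [x _ [[j xj] x0 xS]].
apply: contrapT => lN.
(* Off the unit fractions no coefficient of the recursion vanishes, nor does [l - 1] (the case
   [k = 0]), so every entry of [x] is 0. *)
have lk k : l * k.+1%:R - 1 != 0.
  apply/eqP => /subr0_eq lk; apply: lN; exists k => //.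
  have kN0 : k.+1%:R != 0 :> R[i] by rewrite pnatr_eq0.
  by apply: (mulIf kN0); rewrite mulVf// lk.
have : x j = 0.
  elim: j {xj} => [|j IH].
    by apply/eqP; move/eqP: x0; rewrite mulf_eq0 -[l]mulr1 (negPf (lk 0%N)).
  by apply/eqP; move/eqP: (xS j); rewrite IH mulr0 mulf_eq0 (negPf (lk _)).
by move=> /eqP; rewrite (negPf xj).
Unshelve. all: by end_near. Qed.

End CesaroSpectrum.

(** * Continuity of the inverse under linear decay *)

Section CesaroInverse.
Context {R : realType} {A : kotheMatrix R} (hA : is_G1 A).
Hypothesis K : linear_decay A.
Local Notation X := (lambda0 A).

(** [linear_decay_dom] absorbs the factor of each term; for the second, (G1-1) first moves the
    weight from [i] to [i.-1]. *)
Lemma cesaro_inv_weight n : exists m (D : R), 0 < D /\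
  forall (x : nat -> R[i]) i, A n i * normc (cesaro_inv x i) <=
    D * (A m i * normc (x i) + A m i.-1 * normc (x i.-1)).
Proof.
have [m [D [D0 hD]]] := linear_decay_dom hA K n.
exists m, D; split=> // x i; rewrite /cesaro_inv.
rewrite (le_trans (ler_wpM2l (kothe_ge0 _ _ _) (normc_tri _ _)))//.
rewrite mulrDr normcN !Normc.normcM !normc_nat mulrDr !mulrA.
apply: lerD; rewrite ler_wpM2r ?normc_ge0// mulrC ?hD//.
case: i => [|i] /=; first by rewrite mul0r mulr_ge0 ?kothe_ge0// ltW.
by rewrite (le_trans _ (hD i))// ler_wpM2l//; have [] := G1_1 hA n i.
Qed.

(** The sign is that of the resolvent at 0, the inverse of -C. *)
Lemma lambda0_cesaro_inv (x : X) :
  (fun i => - cesaro_inv (x : nat -> R[i]) i) \in lambda0_pred A.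
Proof.
apply/lambda0_memP => n; have [m [D [_ hD]]] := cesaro_inv_weight n.
have /lambda0_memP/(_ m) xm := lambda0P x.
have h : (fun i => D * (A m i * normc (x i) + A m i.-1 * normc (x i.-1))) @ \oo
    --> (0 : R).
  rewrite -(mulr0 D) -[X in D * X]addr0; apply: cvgM; first exact: cvg_cst.
  by apply: cvgD => //; rewrite -cvg_shiftS.
apply: (squeeze_cvgr _ (cvg_cst 0) h); near=> i.
by rewrite mulr_ge0 ?kothe_ge0 ?normc_ge0//= normcN hD.
Unshelve. all: by end_near. Qed.

Definition cesaro_op_resolvent0 (x : X) : X := Lambda0 (lambda0_cesaro_inv x).

Lemma cesaro_op_resolvent0_linear : linear cesaro_op_resolvent0.
Proof.
move=> k x y; apply/val_inj/funext => i /=.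
rewrite [RHS](_ : _ = k * - cesaro_inv x i - cesaro_inv y i)// /cesaro_inv.
rewrite [X in _ * X](_ : _ = k * x i + y i)//.
rewrite [X in - (_ - _ * X)](_ : _ = k * x i.-1 + y i.-1)//.
ring.
Qed.

HB.instance Definition _ := GRing.isLinear.Build R[i] X X *:%R
  cesaro_op_resolvent0 cesaro_op_resolvent0_linear.

Lemma cesaro_op_resolvent0_continuous : continuous cesaro_op_resolvent0.
Proof.
move=> x U [n [e [e0 hU]]]; have [m [D [D0 hD]]] := cesaro_inv_weight n.
(* The 2 counts the entries at [i] and [i.-1], each bounded by the [m]-th seminorm. *)
exists m, (e / (D * 2)); split; first by rewrite divr_gt0// mulr_gt0.
move=> y /= hy; apply: hU.
suff : kothe_seminorm A n (cesaro_op_resolvent0 y - cesaro_op_resolvent0 x : X) < e.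
  by [].
rewrite -linearB (@le_lt_trans _ _ (D * 2 * kothe_seminorm A m (y - x : X)))//.
  apply: kothe_seminorm_le => i /=; rewrite normcN (le_trans (hD _ _))//.
  rewrite -mulrA ler_wpM2l ?(ltW D0)// mulr_natl mulr2n.
  by rewrite lerD// (kothe_seminorm_ub _ _ (lambda0_in (y - x : X))).
by rewrite mulrC -ltr_pdivlMr// mulr_gt0.
Qed.

HB.instance Definition _ := isContinuous.Build X X
  cesaro_op_resolvent0 cesaro_op_resolvent0_continuous.

Lemma linear_decay_resolvent0 : resolvent_set (cesaro_op hA) 0.
Proof.
exists cesaro_op_resolvent0.
have CK (y : X) : cesaro_op hA (cesaro_op_resolvent0 y) = - y.
  apply/val_inj/funext => i /=.
  rewrite -[RHS](congr1 (fun z => - z i) (cesaro_invK _ _)).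
  by rewrite /arithmetic_mean /series /= sumrN mulrN.
split=> x; last by rewrite scale0r sub0r [X in - X](CK x) opprK.
rewrite scale0r sub0r linearN; apply/val_inj/funext => i.
rewrite [LHS](_ : _ = - - cesaro_inv (arithmetic_mean x) i)//.
by rewrite opprK arithmetic_meanK.
Qed.

End CesaroInverse.

Theorem theorem1 (R : realType) (A : kotheMatrix R) (hA : is_G1 A)
    (A_to0 : forall n : nat, A n i @[i --> \oo] --> (0 : R)) :
  [<-> ~ spectrum (cesaro_op hA) 0;
       point_spectrum (cesaro_op hA) (2%:R^-1);
       exists s : nat, (1 < s)%N /\ point_spectrum (cesaro_op hA) (s%:R^-1);
       unit_fractions = point_spectrum (cesaro_op hA)].
Proof.
tfae=> [/contrapT/(resolvent0_linear_decay _ A_to0)/(linear_decay_spectrum hA) <-||[s [s1]]|pt].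
(* Index 1 stands for 1/2, since [unit_fractions] sends k to 1/(k+1). *)
- by exists 1%N.
- by exists 2%N.
- by move=> /(point_spectrum_linear_decay _ _ s1)/(linear_decay_spectrum hA).
- apply; apply: linear_decay_resolvent0.
  by apply: (@point_spectrum_linear_decay _ _ hA 2) => //; rewrite -pt; exists 1%N.
Qed.
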